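(* Let $\mathcal G=(A,E)$ be a finite graph with vertex set $A=\{x_1,\dots,x_n\}$ (self-edges and multiple edges allowed). Then for every current $\bar k\in\mathcal C$, $$2^{-S(\bar k)}\sum_{\bar\omega:\ \pi(\bar\omega)=\bar k}\ \prod_{j=1}^n\frac{\Gamma(N_j+\frac12)}{N_j!}=\left[\prod_{x\in A}\Gamma\left(n_x+\tfrac12\right)\right]\left[\prod_{e\in E}\frac1{k_e!}\right].$$
   Context: The edges in $E$ are undirected; $E_0\subset E$ is the set of edges that are not self-edges. Put $A_j=A\setminus\{x_1,\dots,x_{j-1}\}$. The sum is over ordered $n$-tuples $\bar\omega=(\omega^1,\dots,\omega^n)$ where $\omega^j$ is a loop in $A_j$ rooted at $x_j$: a sequence of points $[\omega^j_0=x_j,\omega^j_1,\dots,\omega^j_m=x_j]$ with all $\omega_i^j\in A_j$ ($m\ge0$; $m=0$ is the trivial loop), together with a sequence of undirected edges $e_1,\dots,e_m\in E$ such that the endpoints of $e_i$ are $\omega^j_{i-1}$ and $\omega^j_i$. $N_j=\#\{i\ge1:\omega^j_i=x_j\}$ is the number of elementary loops in $\omega^j$. For $e\in E$, $x\in A$: $n_e(x)=2$ if $e$ is a self-edge at $x$, $n_e(x)=1$ if $e\in E_0$ has $x$ as an endpoint, and $n_e(x)=0$ if $e$ does not touch $x$. For $\bar k=\{k_e:e\in E\}\in\mathbb N^E$ ($\mathbb N=\{0,1,2,\dots\}$), $n_x=n_x(\bar k)=\frac12\sum_{e\in E}k_e\,n_e(x)$; $\bar k$ is a current if every $n_x(\bar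 k)$ is an integer, and $\mathcal C$ is the set of currents. $S(\bar k)=\sum_{e\in E_0}k_e$. For an ordered $n$-tuple $\bar\omega=(\omega^1,\dots,\omega^n)$ in which each $\omega^j$ is a loop in $A_j$ rooted at $x_j$, $\pi(\bar\omega)\in\mathcal C$ is the current whose value at $e$ is the total number of traversals of $e$ (in either direction) by $\omega^1,\dots,\omega^n$. *)

(* Defs.v *)
From HB Require Import structures.
From mathcomp Require Import all_boot all_order all_algebra.
From mathcomp Require Import all_classical all_reals all_analysis.

Set Implicit Arguments.
Unset Strict Implicit.
Unset Printing Implicit Defensive.

Import Order.TTheory GRing.Theory Num.Theory.

Local Open Scope classical_set_scope.
Local Open Scope ring_scope.

(* Euler's integral; the integrand is integrable only for s > 0. *)
Definition Gamma (R : realType) (s : R) : R :=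
  (\int[lebesgue_measure]_(t in `]0, +oo[) (t `^ (s - 1) * expR (- t)))%R.

(* A finite undirected graph; e is a self-edge when its set of endpoints is a
   singleton, and several edges may have the same endpoints. *)
Record multigraph (V : finType) := Multigraph {
  edge : finType;
  ends : edge -> {set V};
  card_ends : forall e, (0 < #|ends e| <= 2)%N
}.

Section Multigraph.
Variables (V : finType) (G : multigraph V).

Definition self_edge (e : edge G) : bool := #|ends e| == 1%N.

Definition incidence (e : edge G) (v : V) : nat :=
  if v \notin ends e then 0 else if self_edge e then 2 else 1.

Definition vertex_number (R : realType) (k : {ffun edge G -> nat}) (v : V) : R :=
  2^-1 * (\sum_(e : edge G) k e * incidence e v)%N%:R.

Definition is_current (R : realType) (k : {ffun edge G -> nat}) : Prop :=
  forall v, vertex_number R k v \is a Num.int.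

Definition non_self_total (k : {ffun edge G -> nat}) : nat :=
  (\sum_(e : edge G | ~~ self_edge e) k e)%N.

(* The sequence (e_1, v_1) ... (e_m, v_m) encodes the walk v_0, v_1, ..., v_m
   whose i-th step traverses e_i from v_(i-1) to v_i; the starting point v_0 is
   given separately. *)
Definition steps : Type := seq (edge G * V).

Fixpoint walk_in (D : {set V}) (v : V) (w : steps) : bool :=
  if w is (e, v') :: w' then
    [&& ends e == [set v; v']%SET, v' \in D & walk_in D v' w']
  else true.

Definition loop_in (D : {set V}) (v : V) (w : steps) : bool :=
  [&& v \in D, walk_in D v w & last v (unzip2 w) == v].

(* The starting point is not counted: this is #{i >= 1 : v_i = v}. *)
Definition elementary_loops (v : V) (w : steps) : nat :=
  count_mem v (unzip2 w).

Section LoopTuples.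
Variables (n : nat) (x : 'I_n -> V).

Definition remaining (j : 'I_n) : {set V} :=
  (~: [set x i | i : 'I_n & (i < j)%N])%SET.

Definition loop_tuple (w : {ffun 'I_n -> seq (edge G * V)}) : Prop :=
  forall j, loop_in (remaining j) (x j) (w j).

Definition traversals (w : {ffun 'I_n -> seq (edge G * V)}) :
    {ffun edge G -> nat} :=
  [ffun e => (\sum_(j < n) count_mem e (unzip1 (w j)))%N].

Definition loop_tuples_over (k : {ffun edge G -> nat}) :
    set {ffun 'I_n -> seq (edge G * V)} :=
  [set w | loop_tuple w /\ traversals w = k].

(* Finitely supported sums over these tuples are thus genuine sums. *)
Lemma finite_loop_tuples_over (k : {ffun edge G -> nat}) :
  finite_set (loop_tuples_over k).
Proof.
pose B := (\sum_e k e)%N.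
have sum_count (s : seq (edge G)) : (\sum_e count_mem e s)%N = size s.
  elim: s => [|a s IHs] /=; first by rewrite big1.
  rewrite big_split /= IHs (bigD1 a) //= eqxx big1 ?addn0 ?add1n // => e.
  by rewrite eq_sym => /negbTE ->.
have sizeB w j : loop_tuples_over k w -> (size (w j) < B.+1)%N.
  rewrite /B => -[_ <-]; rewrite ltnS.
  under eq_bigr do rewrite ffunE.
  rewrite exchange_big /= (bigD1 j) //= sum_count size_map.
  exact: leq_addr.
pose T := {m : 'I_B.+1 & m.-tuple (edge G * V)}.
pose f (g : {ffun 'I_n -> T}) : {ffun 'I_n -> seq (edge G * V)} :=
  [ffun j => tval (tagged (g j))].
apply: (@sub_finite_set _ _ (f @` setT)); last first.
  exact/finite_image/finite_finset.
move=> w kw; exists [ffun j => existT (fun m : 'I_B.+1 => m.-tuple _)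
  (Ordinal (sizeB w j kw)) (in_tuple (w j))] => //.
by apply/ffunP => j; rewrite !ffunE.
Qed.

End LoopTuples.
End Multigraph.

(* Main.v *)
(* The value of Gamma at 1/2 plays no role: only Gamma (s + 1) = s * Gamma s is
   used.  Write d_u for the sum over e of k_e n_e(u), so that n_u = d_u / 2, and
   Gamma_d for Gamma ((d + 1) / 2).  For a walk that stands at v and has still to
   traverse k, put
     Phi_v(k) = (\prod_u Gamma_(d_u + [u = v])) (\prod_e 1 / k_e!).
   If d_v > 0, then Phi_v(k) is the sum of c_e Phi_v'(k - e) over the steps (e, v')
   from v, with c_e = 1 for a self-edge and c_e = 1/2 otherwise: each term is
   Phi_v(k) c_e k_e 2 / d_v, and c_e k_e is half of the contribution of e to d_v.
   Hence Phi_r(k) is the sum, over the loops rooted at r that use up all edges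
   at r, of 2^(- number of non-self steps) times the right-hand side of the
   theorem for what is left on the graph without r.  At r itself
   Phi_r has the factor Gamma (n_r + 1) = n_r! and n_r is the number N of
   elementary loops, which accounts for the weight Gamma (N + 1/2) / N!.  The
   theorem follows by removing the vertices one after the other. *)
Require Import Defs.
From mathcomp Require Import all_boot all_order all_algebra.
From mathcomp Require Import all_classical all_reals all_analysis.
From mathcomp Require Import measurable_realfun ring zify.

Set Implicit Arguments.
Unset Strict Implicit.
Unset Printing Implicit Defensive.

Import Order.TTheory GRing.Theory Num.Theory.
Import numFieldNormedType.Exports.
Local Open Scope classical_set_scope.
Local Open Scope ring_scope.

(** * The functional equation of Gamma *)

Section Gamma.
Context {R : realType}.
Notation mu := (@lebesgue_measure R).

Let F (s t : R) : R := t `^ s * expR (- t).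

Lemma continuous_powR_gt0 (s t : R) : 0 < t -> continuous_at t (fun u : R => u `^ s).
Proof.
by move=> t0; apply/differentiable_continuous/derivable1_diffP/derivable_powR;
  rewrite in_itv/= andbT.
Qed.

(** The exponential series gives exp t >= t^(m+1) / (m+1)! for a natural m >= s, so the integrand is
    at most (m+1)! / t once t >= 1. *)
Lemma cvg_powR_expRN (s : R) : F s n.+2%:R @[n --> \oo] --> 0.
Proof.
have [m sm] : exists m : nat, s <= m%:R.
  have [s0|/ltW s0] := leP 0 s; last by exists 0%N.
  by exists (Num.truncn s).+1; exact/ltW/truncnS_gt.
apply: (@squeeze_cvgr _ _ _ _ (fun=> 0) (fun n => m.+1`!%:R * harmonic n)).
- near=> n; rewrite mulr_ge0 ?powR_ge0 ?expR_ge0//=.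
  set t : R := n.+2%:R; have t0 : 0 < t by rewrite ltr0n.
  apply: (@le_trans _ _ (m.+1`!%:R * t^-1)); last first.
    by rewrite ler_pM2l ?ltr0n ?fact_gt0// lef_pV2 ?posrE ?ltr0n// ler_nat.
  rewrite /F expRN ler_pdivrMr ?expR_gt0//.
  apply: (@le_trans _ _ (t ^+ m)).
    by rewrite -(@powR_mulrn _ t m) ?(ltW t0)// ler_powR// ler1n.
  have e1 : t ^+ m.+1 / m.+1`!%:R <= expR t.
    by apply: le_trans (expR_ge1Dxn m (ltW t0)); rewrite lerDr.
  rewrite -[leLHS](_ : m.+1`!%:R * t^-1 * (t ^+ m.+1 / m.+1`!%:R) = _).
    by rewrite ler_pM2l// divr_gt0// ltr0n fact_gt0.
  rewrite exprS; field.
  by rewrite gt_eqF//= pnatr_eq0 -lt0n fact_gt0.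
- exact: cvg_cst.
- by rewrite -[X in _ --> X](mulr0 m.+1`!%:R); apply: cvgMr; exact: cvg_harmonic.
Unshelve. all: by end_near.
Qed.

Lemma cvg_powR_expRN0 (s : R) : 0 < s -> F s n.+1%:R^-1 @[n --> \oo] --> 0.
Proof.
move=> s0.
apply: (@squeeze_cvgr _ _ _ _ (fun=> 0) (fun n => harmonic n `^ s)).
- near=> n; rewrite mulr_ge0 ?powR_ge0 ?expR_ge0//=.
  by rewrite ler_piMr ?powR_ge0// expR_le1 oppr_le0.
- exact: cvg_cst.
- have /cvg_at_rightP := powR_cvg0 s0; apply; split=> [n|]; first by rewrite invr_gt0 ltr0n.
  exact: cvg_harmonic.
Unshelve. all: by end_near.
Qed.

(** Integration by parts with the antiderivative - exp (- t), on an interval away from 0, where t^s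
    is differentiable. *)
Lemma integral_powRS_expRN (s a b : R) : 0 < a < b ->
  (\int[mu]_(t in `[a, b]) (F s t)%:E =
   s%:E * \int[mu]_(t in `[a, b]) (F (s - 1) t)%:E + (F s a - F s b)%:E)%E.
Proof.
move=> /andP[a0 ab].
have itv_gt0 t : t \in `[a, b] -> 0 < t.
  by rewrite in_itv/= => /andP[/(lt_le_trans a0)].
have c2 : continuous (fun t : R => expR (- t)).
  by move=> t; apply: continuous_comp; [exact: opp_continuous|exact: continuous_expR].
have := @integration_by_parts R (fun t => t `^ s) (fun t => - expR (- t))
  (fun t => s * t `^ (s - 1)) (fun t => expR (- t)) a b ab.
have itv_oo t : t \in `]a, b[ -> 0 < t.
  by rewrite in_itv/= => /andP[/(lt_trans a0)].
have cG (h : R -> R) : {for a, continuous h} -> {for b, continuous h} ->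
    {in `]a, b[, forall t, derivable h t 1} -> derivable_oo_LRcontinuous h a b.
  by move=> ha hb; split => //; [exact: cvg_at_right_filter|exact: cvg_at_left_filter].
have dN (t : R) : is_derive t 1 (fun t : R => - expR (- t)) (expR (- t)).
  by apply: is_derive_eq; rewrite mulrN1 opprK.
rewrite /F => ->.
- rewrite addeC; congr (_ + _)%E; last by congr EFin; ring.
  have iF : mu.-integrable `[a, b] (fun t => (F (s - 1) t)%:E).
    apply: continuous_compact_integrable; first exact: segment_compact.
    apply/continuous_in_subspaceT => t; rewrite inE/= => /itv_gt0 t0.
    by apply: cvgM; [exact: continuous_powR_gt0|exact: c2].
  have -> : (\int[mu]_(t in `[a, b]) (s * t `^ (s - 1) * - expR (- t))%:E =
             \int[mu]_(t in `[a, b]) ((- s)%:E * (F (s - 1) t)%:E))%E.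
    by apply: eq_integral => t _; rewrite -EFinM; congr EFin; rewrite /F; ring.
  by rewrite integralZl// EFinN mulNe oppeK.
- apply/continuous_in_subspaceT => t; rewrite inE/= => /itv_gt0 t0.
  by apply: cvgM; [exact: cvg_cst|exact: continuous_powR_gt0].
- apply: cG => [||t /itv_oo t0]; [exact: continuous_powR_gt0| |].
    exact/continuous_powR_gt0/(lt_trans a0).
  by apply: derivable_powR; rewrite in_itv/= andbT.
- by move=> t /itv_oo t0; apply: powR_derive1; rewrite in_itv/= andbT.
- exact: continuous_subspaceT.
- apply: cG => [||t _]; [exact: continuousN (c2 a)|exact: continuousN (c2 b)|].
  exact: ex_derive.
- by move=> t _; rewrite derive1E; exact: derive_val.
Qed.

(* Integration by parts on compact intervals passes to the limit in the extended
   reals, so integrability is not needed: [fine] commutes with multiplication by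
   [s], also at [+oo]. *)
Lemma GammaS (s : R) : 0 < s -> Gamma (s + 1) = s * Gamma s.
Proof.
move=> s0; rewrite /Gamma /Rintegral.
(* The right end is n + 2, not n + 1, so that the interval has positive length also at n = 0. *)
pose U n := `[n.+1%:R^-1 : R, n.+2%:R]%classic.
have UE : \bigcup_n U n = `]0, +oo[%classic.
  apply/seteqP; split=> [t [n _]|t]; rewrite /= !in_itv/= andbT.
    rewrite /U/= in_itv/= => /andP[nt _].
    by apply: lt_le_trans nt; rewrite invr_gt0 ltr0n.
  move=> t0; exists (Num.truncn (Num.max t t^-1)) => //=.
  have := truncnS_gt (Num.max t t^-1).
  rewrite gt_max /U/= in_itv/= => /andP[tn tVn]; apply/andP; split.
    by rewrite invf_ple ?posrE ?ltr0n// ltW.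
  by rewrite ltW// (lt_le_trans tn)// ler_nat.
have Fint r : (\int[mu]_(t in U n) (F r t)%:E @[n --> \oo]
    --> \int[mu]_(t in `]0%R, +oo[) (F r t)%:E)%E.
  rewrite -UE; apply: ge0_nondecreasing_set_cvg_integral.
  - apply/nondecreasing_seqP => n; rewrite subsetEset; apply: subset_itv.
      by rewrite bnd_simp lef_pV2 ?posrE ?ltr0n// ler_nat.
    by rewrite bnd_simp ler_nat.
  - by move=> n; exact: measurable_itv.
  - move=> n; apply/measurable_EFinP; apply: measurable_funTS.
    apply: measurable_funM.
      exact: measurable_powR.
    exact: measurableT_comp.
  - by move=> n t _; rewrite lee_fin mulr_ge0 ?powR_ge0 ?expR_ge0.
have itvn n : 0 < (n.+1%:R^-1 : R) < n.+2%:R.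
  rewrite invr_gt0 ltr0n/= (@le_lt_trans _ _ 1) ?ltr1n//.
  by rewrite invf_le1 ?ltr0n// ler1n.
have IU n : (\int[mu]_(t in U n) (F s t)%:E =
    s%:E * \int[mu]_(t in U n) (F (s - 1) t)%:E
    + (F s n.+1%:R^-1 - F s n.+2%:R)%:E)%E.
  exact: integral_powRS_expRN (itvn n).
have lim : (\int[mu]_(t in U n) (F s t)%:E @[n --> \oo]
    --> s%:E * \int[mu]_(t in `]0%R, +oo[) (F (s - 1) t)%:E + (0 - 0)%:E)%E.
  rewrite (eq_cvg _ _ IU); apply: cvgeD.
  - by rewrite fin_num_adde_defl.
  - by apply: cvgeZl => //; exact: Fint.
  - apply: cvg_EFin; first exact: nearW.
    by apply: cvgB; [exact: cvg_powR_expRN0|exact: cvg_powR_expRN].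
have := cvg_unique (@ereal_hausdorff R) (Fint s) lim.
rewrite subrr adde0 addrK /F => ->.
case: (X in fine (s%:E * X)) => [r//||]; rewrite /= ?mulr0.
  by rewrite gt0_muley ?lte_fin.
by rewrite gt0_muleNy ?lte_fin.
Qed.
End Gamma.

(** * Enumerating the loops with prescribed traversals *)

Section Currents.
Variables (V : finType) (G : multigraph V).
Implicit Types (k : {ffun edge G -> nat}) (D : {set V}) (w : steps G).

Definition degree k u : nat := (\sum_e k e * incidence e u)%N.

Definition supported k D := [forall e, (0 < k e)%N ==> (ends e \subset D)].

Definition drop_edge k (e : edge G) : {ffun edge G -> nat} :=
  [ffun f => k f - (f == e)]%N.

(** Truncated subtraction; it is exact for the walks in [walks], which traverse each edge e at most
    [k e] times. *)
Definition drop_walk k w : {ffun edge G -> nat} :=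
  [ffun f => k f - count_mem f (unzip1 w)]%N.

Definition step D v k (s : edge G * V) :=
  [&& ends s.1 == [set v; s.2]%SET, s.2 \in D & (0 < k s.1)%N].

(* Walks in [D] from [v] to [r], of length at most [m], that traverse each edge
   [e] at most [k e] times. *)
Fixpoint walks D r m v k : seq (steps G) :=
  (if v == r then [:: [::]] else [::]) ++
  (if m is m'.+1 then
     [seq s :: w | s <- enum (step D v k), w <- walks D r m' s.2 (drop_edge k s.1)]
   else [::]).

(** The loop at the head of the list may visit only the vertices still listed. The final test keeps
    the choices that use up k. *)
Fixpoint loop_lists xs k : seq (seq (steps G)) :=
  if xs is r :: xs' then
    [seq w :: ws | w <- walks [set z in xs] r (\sum_e k e)%N r k,
                   ws <- loop_lists xs' (drop_walk k w)]
  else if k == [ffun=> 0%N] then [:: [::]] else [::].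

Fixpoint loops_along xs (ws : seq (steps G)) : bool :=
  match xs, ws with
  | r :: xs', w :: ws' => loop_in [set z in xs] r w && loops_along xs' ws'
  | [::], [::] => true
  | _, _ => false
  end.

(** Half-edges are counted: a self-edge has v = v' and so counts twice at v. *)
Lemma incidence_ends (e : edge G) u v v' : ends e = [set v; v']%SET ->
  incidence e u = ((u == v) + (u == v'))%N.
Proof.
move=> ev; rewrite /incidence /self_edge ev !inE cards2.
case: (eqVneq v v') => [<-|vv']; first by case: (u == v).
by case: (eqVneq u v) => [->|_] /=; [rewrite (negbTE vv')|case: (u == v')].
Qed.

Lemma degree_drop_edge k e u v v' : ends e = [set v; v']%SET -> (0 < k e)%N ->
  degree k u = (degree (drop_edge k e) u + ((u == v) + (u == v')))%N.
Proof.
move=> ev ke; rewrite /degree -(incidence_ends u ev) (bigD1 e)//=.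
rewrite [in RHS](bigD1 e)//= ffunE eqxx.
rewrite [in RHS](eq_bigr (fun i => k i * incidence i u)%N); last first.
  by move=> i ie; rewrite ffunE (negbTE ie) subn0.
rewrite subn1; move: (\sum_(_ | _) _)%N; nia.
Qed.

Lemma total_drop_edge k e : (0 < k e)%N ->
  (\sum_f k f = (\sum_f drop_edge k e f).+1)%N.
Proof.
move=> ke; rewrite (bigD1 e)//= [in RHS](bigD1 e)//= ffunE eqxx.
rewrite [in RHS](eq_bigr k) => [|i ie]; last by rewrite ffunE (negbTE ie) subn0.
by rewrite -addSn subn1 prednK.
Qed.

Lemma drop_walk_nil k : drop_walk k [::] = k.
Proof. by apply/ffunP => e; rewrite ffunE subn0. Qed.

Lemma drop_walk_cons k s w : drop_walk k (s :: w) = drop_walk (drop_edge k s.1) w.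
Proof. by apply/ffunP => e; rewrite !ffunE/= eq_sym subnDA. Qed.

Lemma supported_drop_edge k e D : supported k D -> supported (drop_edge k e) D.
Proof.
move=> /forallP kD; apply/forallP => f; apply/implyP; rewrite ffunE => kf.
by apply: (implyP (kD f)); apply: leq_trans kf _; exact: leq_subr.
Qed.

Lemma mem_walks D r m v k w : (w \in walks D r m v k) =
  [&& walk_in D v w, last v (unzip2 w) == r,
      [forall e, count_mem e (unzip1 w) <= k e]%N & (size w <= m)%N].
Proof.
elim: m v k w => [|m IH] v k w /=; rewrite mem_cat.
  case: w => [|s w] /=; last by rewrite !andbF; case: ifP.
  rewrite orbF andbT; case: eqP => //= _; rewrite ?inE//.
  by apply/esym/forallP.
case: w => [|[e v'] w] /=.
  rewrite andbT; case: eqP => //= _.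
    by apply/esym/forallP.
  by apply/negbTE/negP => /allpairsPdep[? [? []]].
have -> : ((e, v') :: w \in if v == r then [:: [::]] else [::]) = false.
  by case: ifP.
apply/allpairsPdep/idP => [[s [w1 [+ + [es ew]]]]|].
  subst s w1; rewrite mem_enum => /and3P[/= /eqP ev v'D ke].
  rewrite IH => /and4P[-> -> /forallP kw sw].
  rewrite ev eqxx v'D ltnS sw/= andbT; apply/forallP => f.
  have := kw f; rewrite ffunE (eq_sym f).
  case: eqVneq => [<-|_] /=; last by rewrite subn0.
  by rewrite -ltnS add1n -(prednK ke) subn1.
move=> /and4P[/and3P[ev v'D Dw] l /forallP kw sw]; exists (e, v'), w.
rewrite mem_enum; split => //.
  apply/and3P; split => //=.
  by have := kw e; rewrite eqxx add1n; apply: leq_trans.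
rewrite IH Dw l -ltnS sw /= andbT; apply/forallP => f.
have := kw f; rewrite ffunE (eq_sym f).
case: eqVneq => [<-|_] /=; last by rewrite subn0.
by rewrite add1n subn1; case: (k e).
Qed.

Lemma uniq_walks D r m v k : uniq (walks D r m v k).
Proof.
elim: m v k => [|m IH] v k /=; first by rewrite cats0; case: ifP.
rewrite cat_uniq; apply/and3P; split; first by case: ifP.
  apply/hasPn => _ /allpairsPdep[s [w [_ _ ->]]].
  by case: ifP.
apply: allpairs_uniq_dep; first exact: enum_uniq.
  by move=> s _; exact: IH.
by move=> [s w] [s' w'] _ _ /= [-> ->].
Qed.

(** Each step uses one half-edge where it starts and one where it ends, so a visit to u counts
    twice, up to corrections at the two ends of the walk. For a loop these cancel. *)
Lemma walk_degree D v w u : walk_in D v w ->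
  (\sum_e count_mem e (unzip1 w) * incidence e u + (last v (unzip2 w) == u)
   = (count_mem u (unzip2 w)).*2 + (v == u))%N.
Proof.
elim: w v => [|[e v'] w IH] v /=; first by rewrite big1.
move=> /and3P[/eqP ev _ /IH]; move: (last _ _) => l IHw.
under eq_bigr do rewrite mulnDl.
rewrite big_split/= (bigD1 e)//= eqxx mul1n big1 => [|f]; last first.
  by rewrite eq_sym => /negbTE ->.
rewrite (incidence_ends u ev) addn0 -addnA IHw doubleD (eq_sym u v) (eq_sym u v').
by rewrite -muln2; lia.
Qed.

Lemma degree_drop_walk k w u :
  (forall e, count_mem e (unzip1 w) <= k e)%N ->
  (degree (drop_walk k w) u + \sum_e count_mem e (unzip1 w) * incidence e u
   = degree k u)%N.
Proof.
move=> kw; rewrite /degree -big_split/=; apply: eq_bigr => e _.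
by rewrite ffunE -mulnDl subnK.
Qed.

Lemma walk_ends_subset D v w e : v \in D -> walk_in D v w ->
  (0 < count_mem e (unzip1 w))%N -> ends e \subset D.
Proof.
elim: w v => [|[f v'] w IH] v //= vD /and3P[/eqP ev v'D wD].
case: eqVneq => [<- _|_]; last by rewrite add0n; exact: IH wD.
by rewrite ev; apply/fintype.subsetP => z; rewrite !inE => /orP[]/eqP->.
Qed.

(** A step from v is determined by its edge, since the other end is forced (v itself for a
    self-edge). The support of k puts that end in D. *)
Lemma card_step D k v e : v \in D -> supported k D ->
  #|[pred v' | step D v k (e, v')]| = ((v \in ends e) && (0 < k e)%N).
Proof.
move=> vD /forallP/(_ e)/implyP kD.
case: (ltnP 0 (k e)) => ke; last first.
  rewrite andbF; apply: eq_card0 => z.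
  by rewrite !inE /step/= [(0 < _)%N]ltnNge ke !andbF.
rewrite andbT; case: (boolP (v \in ends e)) => ve; last first.
  apply: eq_card0 => z; rewrite !inE /step/=; apply/negP => /and3P[/eqP ev _ _].
  by rewrite ev !inE eqxx in ve.
have [v' ev] : exists v', ends e = [set v; v']%SET.
  have := cardsD1 v (ends e); rewrite ve; have := card_ends e.
  case: (set_0Vmem (ends e :\ v)) => [e0|[v' v'e]] e2 c.
    by exists v; rewrite -(finset.setD1K ve) e0 finset.setU0 finset.setUid.
  exists v'; rewrite -(finset.setD1K ve); congr (_ |: _)%SET.
  by apply/esym/eqP; rewrite eqEcard finset.sub1set v'e cards1; lia.
rewrite /= -(card1 v'); apply: eq_card => z; rewrite !inE /step/= ev ke andbT.
apply/andP/eqP => [[/eqP vz _]|->].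
  have : z \in [set v; v']%SET by rewrite vz !inE eqxx orbT.
  have : v' \in [set v; z]%SET by rewrite -vz !inE eqxx orbT.
  by rewrite !inE => v'z /orP[|]/eqP zv //; move: v'z; rewrite zv orbb => /eqP.
split => //; have /fintype.subsetP := kD ke; apply.
by rewrite ev !inE eqxx orbT.
Qed.

Lemma size_walk w : (\sum_e count_mem e (unzip1 w) = size w)%N.
Proof.
elim: w => [|[a v] w IH] /=; first by rewrite big1.
rewrite big_split /= IH (bigD1 a) //= eqxx big1 ?addn0 ?add1n // => e.
by rewrite eq_sym => /negbTE ->.
Qed.

Lemma mem_loop_lists xs k ws : (ws \in loop_lists xs k) =
  loops_along xs ws &&
  [forall e, \sum_(w <- ws) count_mem e (unzip1 w) == k e]%N.
Proof.
elim: xs k ws => [|r xs IH] k [|w ws]/=.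
- case: eqP => [->|k0].
    by apply/esym/forallP => e; rewrite big_nil ffunE.
  apply/esym/negbTE/forallP => k0'; apply: k0; apply/ffunP => e.
  by rewrite ffunE; have := k0' e; rewrite big_nil => /eqP.
- by case: eqP.
- by apply/negbTE/allpairsPdep => -[? [? []]].
apply/allpairsPdep/idP => [[w1 [ws1 [+ + [ew ews]]]]|].
  subst w1 ws1.
  rewrite mem_walks IH => /and4P[Dw lw /forallP kw _] /andP[-> /forallP rw].
  rewrite /loop_in Dw lw !inE eqxx/=; apply/forallP => e.
  by rewrite big_cons (eqP (rw e)) ffunE subnKC.
rewrite /loop_in => /andP[/andP[/and3P[_ Dw lw] ok] /forallP sw].
have kw e : (count_mem e (unzip1 w) <= k e)%N.
  by rewrite -(eqP (sw e)) big_cons leq_addr.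
exists w, ws; split => //.
  (* The length bound excludes nothing: the length of a walk is its total number of traversals. *)
  rewrite mem_walks Dw lw/= -size_walk leq_sum//= andbT.
  exact/forallP.
rewrite IH ok; apply/forallP => e; rewrite ffunE -(eqP (sw e)) big_cons.
by rewrite addKn.
Qed.

Lemma uniq_loop_lists xs k : uniq (loop_lists xs k).
Proof.
elim: xs k => [|r xs IH] k /=; first by case: ifP.
apply: allpairs_uniq_dep; first exact: uniq_walks.
  by move=> w _; exact: IH.
by move=> [w ws] [w' ws'] _ _ /= [-> ->].
Qed.

Lemma loops_alongP xs (ws : seq (steps G)) :
  reflect (size ws = size xs /\ forall x0 i, (i < size xs)%N ->
             loop_in [set z in drop i xs] (nth x0 xs i) (nth [::] ws i))
          (loops_along xs ws).
Proof.
elim: xs ws => [|r xs IH] [|w ws] /=; try by constructor => // -[].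
apply: (iffP andP) => [[rw /IH[sz h]]|[[sz] h]]; split.
- by rewrite sz.
- by move=> x0 [|i]//; exact: h.
- exact: (h r 0%N).
- by apply/IH; split => // x0 i ixs; exact: (h x0 i.+1).
Qed.

(** This identifies the domains in [loops_along] with those in the theorem; surjectivity of x makes
    the complement of the first j vertices the rest of the list. *)
Lemma drop_codom n (x : 'I_n -> V) (j : 'I_n) : bijective x ->
  [set z in drop j (codom x)]%SET = remaining x j.
Proof.
move=> bx; have [y _ yK] := bx; have xI := bij_inj bx.
apply/setP => z; rewrite !inE -[z]yK /codom /image_mem -map_drop mem_map//.
rewrite (mem_imset _ _ xI) !inE -leqNgt.
rewrite -(mem_map val_inj) map_drop val_enum_ord drop_iota mem_iota.
by rewrite add0n subnKC ?ltn_ord ?andbT// ltnW.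
Qed.

(** * Weighted sums over loops *)

Section Weights.
(** Here [g d] stands for Gamma ((d + 1) / 2): [gSS] is the functional equation and [g1] the value
    at 1. *)
Variables (R : realType) (g : nat -> R).
Hypothesis gSS : forall d, g d.+2 = d.+1%:R / 2 * g d.
Hypothesis g1 : g 1%N = 1.

Definition half_unless_self (e : edge G) : R := if self_edge e then 1 else 2^-1.

(* Phi_v(k); the shift by [u == v] counts the half-edge through which the walk
   has arrived. *)
Definition weight D v k : R :=
  (\prod_(u in D) g (degree k u + (u == v))%N) * \prod_e ((k e)`!%:R)^-1.

(** The step removes a half-edge at v and one at v', and the arrival at v' restores the latter. So
    only the index at v changes, from d_v + 1 to d_v - 1, which costs d_v / 2 by [gSS]; the
    factorial of [k e] gives the factor [k e]. *)
Lemma weight_step D v k (s : edge G * V) :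
  v \in D -> (0 < degree k v)%N -> step D v k s ->
  weight D s.2 (drop_edge k s.1) = (k s.1)%:R * (2 / (degree k v)%:R) * weight D v k.
Proof.
case: s => e v' vD dv /and3P[/= /eqP ev v'D ke].
rewrite /weight (bigD1 v)//= [in RHS](bigD1 v)//= eqxx addn1.
have degE u : (degree (drop_edge k e) u + (u == v') = degree k u - (u == v))%N.
  by rewrite (degree_drop_edge u ev ke) addnCA addKn.
rewrite degE eqxx subn1.
rewrite (eq_bigr (fun u => g (degree k u + (u == v))%N)); last first.
  by move=> u /andP[_ /negbTE uv]; rewrite degE uv subn0 addn0.
rewrite (bigD1 e)//= [in X in _ = _ * X](bigD1 e)//= ffunE eqxx subn1.
rewrite (eq_bigr (fun i => (k i)`!%:R^-1 : R)); last first.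
  by move=> i ie; rewrite ffunE (negbTE ie) subn0.
case: (degree k v) dv => // d _; rewrite gSS /=.
case: (k e) ke => // m _; rewrite factS natrM invfM /=.
have d0 : d.+1%:R != 0 :> R by rewrite pnatr_eq0.
have m0 : m.+1%:R != 0 :> R by rewrite pnatr_eq0.
have f0 : m`!%:R != 0 :> R by rewrite pnatr_eq0 -lt0n fact_gt0.
by field; apply/and3P.
Qed.

(** At an endpoint v of e, [half_unless_self e] is half of n_e(v), for self-edges and other edges
    alike. *)
Lemma sum_half_edges k v :
  \sum_(e | (v \in ends e) && (0 < k e)%N) half_unless_self e * (k e)%:R
  = (degree k v)%:R / 2.
Proof.
rewrite /degree natr_sum mulr_suml big_mkcond/=; apply: eq_bigr => e _.
rewrite /half_unless_self /incidence.
case: (v \in ends e) => /=; last by rewrite muln0 mul0r.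
case: (posnP (k e)) => [->|ke]; first by rewrite !mul0r.
by case: ifP => _; rewrite ?muln1 ?natrM; field.
Qed.

Lemma sum_weight_step D v k : v \in D -> supported k D -> (0 < degree k v)%N ->
  \sum_(s | step D v k s) half_unless_self s.1 * weight D s.2 (drop_edge k s.1)
  = weight D v k.
Proof.
move=> vD kD dv.
have d0 : (degree k v)%:R != 0 :> R by rewrite pnatr_eq0 -lt0n.
transitivity (\sum_(s | step D v k s) half_unless_self s.1 * (k s.1)%:R *
    (2 / (degree k v)%:R * weight D v k)).
  by apply: eq_bigr => s ss; rewrite (weight_step vD dv ss); ring.
rewrite -mulr_suml.
rewrite -(pair_big_dep xpredT (fun e v' => step D v k (e, v'))
  (fun e _ => half_unless_self e * (k e)%:R))/=.
rewrite (eq_bigr (fun e => if (v \in ends e) && (0 < k e)%N then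
  half_unless_self e * (k e)%:R else 0)); last first.
  move=> e _; rewrite sumr_const card_step//.
  by case: ifP; rewrite ?mulr1n ?mulr0n.
by rewrite -big_mkcond/= sum_half_edges; field.
Qed.

Definition walk_weight w : R := \prod_(s <- w) half_unless_self s.1.

(** The indicator discards walks that leave an edge at r; the other factor is the right-hand side of
    the theorem on the graph without r. *)
Definition rest_weight D r k : R :=
  (degree k r == 0%N)%:R *
  ((\prod_(u in D :\ r) g (degree k u)) * \prod_e ((k e)`!%:R)^-1).

(** Induction on the number of traversals still to be made. Odd degrees mark the two ends of the
    walk, so d_v = 0 forces v = r and only the empty walk remains; otherwise the sum splits by the
    first step and [sum_weight_step] applies. *)
Lemma sum_walks D r m v k : (\sum_e k e = m)%N -> v \in D -> r \in D ->
  supported k D -> (forall u, odd (degree k u) = (u == v) (+) (u == r)) ->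
  \sum_(w <- walks D r m v k) walk_weight w * rest_weight D r (drop_walk k w)
  = weight D v k.
Proof.
have stop v' k' : v' \in D -> r \in D -> (degree k' v' = 0)%N ->
    (forall u, odd (degree k' u) = (u == v') (+) (u == r)) ->
    v' = r /\ rest_weight D r k' = weight D v' k'.
  move=> vD rD dv par; have := par v'; rewrite dv eqxx /=.
  case: eqP => // vr _; split=> //; subst v'.
  rewrite /rest_weight /weight dv eqxx mul1r [in RHS](big_setD1 r)//=.
  rewrite dv eqxx g1 mul1r; congr (_ * _); apply: eq_bigr => u.
  by rewrite !inE => /andP[/negbTE -> _]; rewrite addn0.
elim: m v k => [|m IH] v k km vD rD kD par /=; rewrite big_cat/=.
  have dv : degree k v = 0%N.
    move/eqP: km; rewrite sum_nat_eq0 => /forallP/= k0.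
    by apply: big1 => e _; rewrite (eqP (k0 e)).
  have [vr <-] := stop v k vD rD dv par.
  by rewrite vr eqxx big_nil addr0 big_seq1 /walk_weight big_nil mul1r drop_walk_nil.
rewrite big_allpairs_dep/= big_enum/= (eq_bigl (step D v k))//.
case: (posnP (degree k v)) => dv.
  have [vr <-] := stop v k vD rD dv par.
  rewrite [X in _ + X]big_pred0 ?addr0 => [|[e v']].
    by rewrite vr eqxx big_seq1 /walk_weight big_nil mul1r drop_walk_nil.
  apply/negbTE/negP => /and3P[/= /eqP ev _ ke].
  by have := degree_drop_edge v ev ke; rewrite dv eqxx; lia.
(* For d_v > 0 the empty walk, listed only if v = r, leaves edges at r and contributes 0. *)
rewrite [X in X + _](_ : _ = 0) ?add0r.
  rewrite -[RHS](sum_weight_step vD kD dv).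
  rewrite [LHS]big_mkcond [RHS]big_mkcond; apply: eq_bigr => -[e v'] _.
  case: ifP => // /and3P[/= /eqP ev v'D ke].
  rewrite -(IH v' (drop_edge k e)) //; first last.
  - move=> u; have := par u; rewrite (degree_drop_edge u ev ke) !oddD !oddb.
    by case: (odd _) (u == v) (u == v') (u == r) => [] [] [] [].
  - exact: supported_drop_edge.
  - by have := total_drop_edge ke; rewrite km => -[].
  rewrite mulr_sumr; apply: eq_bigr => w _.
  by rewrite drop_walk_cons /walk_weight big_cons mulrA.
case: eqP => [vr|_]; last by rewrite big_nil.
by rewrite big_seq1 drop_walk_nil /rest_weight -vr (gtn_eqF dv) mul0r mulr0.
Qed.

Lemma g_doubleS m : g m.*2.+1 = m`!%:R.
Proof.
elim: m => [|m IH]; first by rewrite g1.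
rewrite doubleS gSS IH factS natrM.
by rewrite -[m.*2.+2]/(m.+1.*2) -muln2 natrM; field.
Qed.

(** As g (2 N) is Gamma (N + 1/2), this is the weight of a loop in the theorem. *)
Definition loop_weight (p : V * steps G) : R :=
  g (elementary_loops p.1 p.2).*2 / (elementary_loops p.1 p.2)`!%:R.

Lemma sum_loop_lists xs k : uniq xs -> (forall u, ~~ odd (degree k u)) ->
  \sum_(ws <- loop_lists xs k)
    (\prod_(w <- ws) walk_weight w) * \prod_(p <- zip xs ws) loop_weight p
  = if supported k [set z in xs] then
      (\prod_(u in [set z in xs]) g (degree k u)) * \prod_e ((k e)`!%:R)^-1
    else 0.
Proof.
elim: xs k => [|r xs IH] k.
  move=> _ _ /=; case: eqP => [->|k0].
    rewrite big_seq1 !big_nil mulr1 ifT.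
      rewrite big_pred0 => [|u]; last by rewrite !inE.
      by rewrite mul1r big1// => e _; rewrite ffunE fact0 invr1.
    by apply/forallP => e; rewrite ffunE.
  rewrite big_nil ifF//; apply/negP => /forallP ksupp; apply: k0.
  apply/ffunP => e; rewrite ffunE; apply/eqP; rewrite -leqn0 leqNgt.
  apply/negP => /(implyP (ksupp e)) /subset_leq_card.
  have -> : #|[set z : V in [::]]%SET| = 0%N.
    by apply: eq_card0 => u; rewrite !inE.
  by have := card_ends e; lia.
move=> /= /andP[rxs uxs] even.
set D := [set z in r :: xs]%SET; set D' := [set z in xs]%SET.
have rD : r \in D by rewrite !inE eqxx.
have D'E : D' = (D :\ r)%SET.
  apply/setP => u; rewrite !inE; case: eqVneq => [->|]//=.
  exact/negbTE.
rewrite big_allpairs_dep/=.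
have walk_rem w : w \in walks D r (\sum_e k e)%N r k -> [/\ walk_in D r w,
    (forall e, count_mem e (unzip1 w) <= k e)%N & forall u,
    degree k u = (degree (drop_walk k w) u + (elementary_loops u w).*2)%N].
  rewrite mem_walks => /and4P[Dw /eqP lw /forallP kw _]; split => // u.
  have := walk_degree u Dw; rewrite lw => /addIn wu.
  by rewrite -(degree_drop_walk u kw) wu.
rewrite big_seq.
(* By induction a loop whose rest is not supported on the remaining vertices contributes 0. Any
   other loop uses up the edges at r, so it has d_r / 2 elementary loops and its loop weight is a
   constant factor. *)
rewrite (eq_bigr (fun w => if supported (drop_walk k w) D' then
   g (degree k r) / (degree k r)./2`!%:R *
   (walk_weight w * rest_weight D r (drop_walk k w)) else 0)); last first.
  move=> w /walk_rem[Dw kw deg].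
  under eq_bigr => ws _ do rewrite !big_cons mulrACA.
  rewrite -mulr_sumr IH//; last first.
    by move=> u; have := even u; rewrite deg oddD odd_double addbF.
  case: ifP => sup; last by rewrite mulr0.
  have r0 : degree (drop_walk k w) r = 0%N.
    apply: big1 => e _; case: (posnP (drop_walk k w e)) => [->//|re].
    rewrite /incidence; case: (boolP (r \in ends e)) => re'; last by rewrite muln0.
    have /fintype.subsetP/(_ _ re') := implyP (forallP sup e) re.
    by rewrite inE (negbTE rxs).
  rewrite /rest_weight r0 eqxx -D'E /loop_weight/= deg r0 add0n doubleK -/D'; ring.
case: (boolP (supported k D)) => [kD|].
  transitivity (g (degree k r) / (degree k r)./2`!%:R * weight D r k).
    rewrite -(@sum_walks D r (\sum_e k e)%N r k)//; last first.
      by move=> u; rewrite addbb; exact/negbTE.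
    rewrite mulr_sumr [RHS]big_seq; apply: eq_bigr => w /walk_rem[Dw kw deg].
    case: ifP => // /negP sup.
    (* When k is supported in D, the test on the rest and the indicator in [rest_weight] agree: both
       ask that no edge at r be left. *)
    rewrite /rest_weight; case: eqP => [r0|]; last by rewrite mul0r !mulr0.
    exfalso; apply: sup; apply/forallP => e; apply/implyP => re.
    have : (0 < k e)%N by move: re; rewrite ffunE; lia.
    move=> /(implyP (forallP kD e)); rewrite D'E subsetD1 => -> /=.
    apply/negP => re'; move/eqP: r0; rewrite sum_nat_eq0 => /forallP/(_ e).
    rewrite muln_eq0 (gtn_eqF re)/= /incidence re'/=.
    by case: ifP.
  (* The factor g (d_r + 1) = (d_r / 2)! cancels the factorial of the loop weight and leaves g
     (d_r). *)
  rewrite /weight (big_setD1 r)//= [in RHS](big_setD1 r)//= eqxx addn1.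
  have := odd_double_half (degree k r); rewrite (negbTE (even r)) add0n.
  move: (_./2) => d <-; rewrite g_doubleS.
  rewrite (eq_bigr (fun u => g (degree k u))); last first.
    by move=> u; rewrite !inE => /andP[/negbTE -> _]; rewrite addn0.
  field.
  by rewrite pnatr_eq0 -lt0n fact_gt0.
move=> /forallPn[e]; rewrite negb_imply => /andP[ke eD].
apply: big1 => w /walk_rem[Dw kw deg]; rewrite ifF//.
apply/negP => /forallP/(_ e)/implyP.
(* An edge not contained in D is never traversed, so it is left in full. *)
have -> : drop_walk k w e = k e.
  rewrite ffunE; case: (posnP (count_mem e (unzip1 w))) => [->|ce].
    by rewrite subn0.
  by rewrite (walk_ends_subset rD Dw ce) in eD.
move=> /(_ ke) eD'; move/negP: eD; apply.
by apply: fintype.subset_trans eD' _; rewrite D'E subD1set.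
Qed.

(** * Passage from lists of loops to the sum over tuples *)

Lemma prod_walk_weight (ws : seq (steps G)) k :
  (forall e, \sum_(w <- ws) count_mem e (unzip1 w) = k e)%N ->
  \prod_(w <- ws) walk_weight w = 2 ^- non_self_total k.
Proof.
move=> wsk.
have -> : 2 ^- non_self_total k = \prod_e half_unless_self e ^+ k e :> R.
  rewrite /non_self_total -exprVn -prodrXr [LHS]big_mkcond/=.
  apply: eq_bigr => e _; rewrite /half_unless_self if_neg.
  by case: ifP; rewrite ?expr1n.
under [RHS]eq_bigr => e _ do rewrite -wsk -prodrXr.
rewrite exchange_big/=; apply: eq_bigr => w _.
elim: w => [|[a v] w IH]; first by rewrite big1 /walk_weight ?big_nil.
rewrite /walk_weight big_cons -/(walk_weight w) IH.
under [RHS]eq_bigr do rewrite /= exprD.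
rewrite big_split/=; congr (_ * _).
rewrite (bigD1 a)//= eqxx big1 ?mulr1// => e.
by rewrite eq_sym => /negbTE ->.
Qed.

Lemma sum_loop_tuples n (x : 'I_n -> V) k : bijective x ->
  (forall u, ~~ odd (degree k u)) ->
  2 ^- non_self_total k * (\sum_(w \in loop_tuples_over x k)
     \prod_(j < n) loop_weight (x j, w j))
  = (\prod_u g (degree k u)) * \prod_e ((k e)`!%:R)^-1.
Proof.
move=> bx even; have xI := bij_inj bx; have [y _ yK] := bx.
(* The default [[::]] is never reached, since the lists in question have length n. *)
pose F (ws : seq (steps G)) := [ffun j : 'I_n => nth [::] ws j].
have sz ws : ws \in loop_lists (codom x) k -> size ws = n.
  rewrite mem_loop_lists => /andP[/loops_alongP[-> _] _].
  by rewrite size_codom card_ord.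
have loop_lists_sum ws e : size ws = n ->
    (\sum_(w <- ws) count_mem e (unzip1 w) =
     \sum_(j < n) count_mem e (unzip1 (F ws j)))%N.
  move=> wsn; rewrite (big_nth [::]) wsn big_mkord.
  by apply: eq_bigr => j _; rewrite ffunE.
have setE : loop_tuples_over x k =
    [set` [seq F ws | ws <- loop_lists (codom x) k]]%classic.
  apply/seteqP; split => [w [wl wk]|_ /mapP[ws ws_in ->]].
    apply/mapP; exists [seq w j | j <- enum 'I_n].
      rewrite mem_loop_lists; apply/andP; split.
        apply/loops_alongP; split => [|x0 i].
          by rewrite size_codom size_map size_enum_ord card_ord.
        rewrite size_codom card_ord => i_n.
        rewrite -[i]/(nat_of_ord (Ordinal i_n)); move: (Ordinal i_n) => j.
        have := wl j; rewrite -drop_codom//.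
        by rewrite !(nth_map j) -?enumT ?size_enum_ord// nth_ord_enum.
      apply/forallP => e; rewrite big_map big_enum/= -wk ffunE.
      exact/eqP.
    apply/ffunP => j; rewrite ffunE (nth_map j) ?size_enum_ord//.
    by rewrite nth_ord_enum.
  have wsn := sz _ ws_in.
  move: ws_in; rewrite mem_loop_lists => /andP[/loops_alongP[_ wsl] /forallP wsk].
  split.
    move=> j; rewrite ffunE -drop_codom//.
    have := wsl (x j) j; rewrite size_codom card_ord => /(_ (ltn_ord j)).
    by rewrite (nth_map j) ?size_enum_ord// nth_ord_enum.
  by apply/ffunP => e; rewrite ffunE -loop_lists_sum//; exact/eqP.
(* The sum over the set becomes a sum over a list without repetitions, as [F] is injective on lists
   of length n. *)
rewrite setE -fsbig_seq/=; last first.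
  rewrite map_inj_in_uniq ?uniq_loop_lists// => ws ws' /sz wsn /sz wsn' /ffunP FE.
  apply: (@eq_from_nth _ [::]); first by rewrite wsn.
  by move=> i; rewrite wsn => i_n; have := FE (Ordinal i_n); rewrite !ffunE.
rewrite big_map mulr_sumr.
rewrite big_seq (eq_bigr (fun ws => (\prod_(w <- ws) walk_weight w) *
    \prod_(p <- zip (codom x) ws) loop_weight p)); last first.
  move=> ws ws_in; have wsn := sz _ ws_in.
  move: ws_in; rewrite mem_loop_lists => /andP[_ /forallP wsk].
  rewrite (@prod_walk_weight ws k) => [|e]; last exact/eqP.
  congr (_ * _).
  have wsE : ws = map (F ws) (enum 'I_n).
    apply: (@eq_from_nth _ [::]); first by rewrite size_map size_enum_ord.
    move=> i; rewrite wsn => i_n; rewrite -[i]/(nat_of_ord (Ordinal i_n)).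
    move: (Ordinal i_n) => j.
    by rewrite (nth_map j) ?size_enum_ord// nth_ord_enum ffunE.
  by rewrite [in RHS]wsE zip_map big_map big_enum/=.
rewrite -big_seq sum_loop_lists//; last by rewrite map_inj_uniq ?enum_uniq.
(* All vertices are listed, so every k is supported. *)
have setT_codom : [set z in codom x]%SET = [set: V]%SET.
  by apply/setP => z; rewrite !inE -[z]yK codom_f.
rewrite setT_codom ifT; last by apply/forallP => e; rewrite finset.subsetT implybT.
by under eq_bigl do rewrite inE.
Qed.

End Weights.
End Currents.

(** * Specialization to Gamma *)

(* Gamma ((d + 1) / 2), with a factorial for odd [d], which spares the proof of
   Gamma 1 = 1. *)
Definition gammas (R : realType) (d : nat) : R :=
  if odd d then (d./2)`!%:R else Gamma ((d./2)%:R + 2^-1).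

Lemma gammasSS (R : realType) d : gammas R d.+2 = d.+1%:R / 2 * gammas R d.
Proof.
rewrite /gammas/= negbK -[in d.+1%:R](odd_double_half d).
case: (odd d); set m := d./2.
  by rewrite factS natrM add1n -doubleS -muln2 natrM mulfK.
rewrite -natr1 addrAC GammaS; last by rewrite ltr_wpDl// invr_gt0.
rewrite add0n -(natr1 m.*2) -muln2 natrM; congr (_ * _).
by field.
Qed.

Lemma current_even (R : realType) (V : finType) (G : multigraph V)
    (k : {ffun edge G -> nat}) u : is_current R k -> ~~ odd (degree k u).
Proof.
move=> /(_ u) /intrP[m mE]; have : (degree k u)%:Z = m * 2.
  apply: (@intr_inj R); rewrite intrM -mE /vertex_number -/(degree k u).
  by field.
by lia.
Qed.

Unset Implicit Arguments.

Theorem theorem3 (R : realType) (V : finType) (G : multigraph V)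
    (n : nat) (x : 'I_n -> V) (k : {ffun edge G -> nat}) :
  bijective x ->
  is_current R k ->
  2 ^- non_self_total k *
    (\sum_(w \in loop_tuples_over x k)
       \prod_(j < n) (Gamma ((elementary_loops (x j) (w j))%:R + 2^-1 : R)
                      / ((elementary_loops (x j) (w j))`!)%:R))
  = (\prod_(v : V) Gamma (vertex_number R k v + 2^-1))
    * (\prod_(e : edge G) ((k e)`!)%:R^-1).
Proof.
move=> bx kc.
have even u := current_even u kc.
have halfE u : vertex_number R k u = (degree k u)./2%:R.
  rewrite /vertex_number -/(degree k u) -[in LHS](odd_double_half (degree k u)).
  by rewrite (negbTE (even u)) add0n -muln2 natrM; field.
(* Only even indices occur on both sides, and there [gammas] is Gamma itself. *)
transitivity ((\prod_u gammas R (degree k u)) * \prod_e ((k e)`!%:R)^-1).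
  rewrite -(sum_loop_tuples (@gammasSS R) _ bx even)//.
  congr (_ * _); apply: eq_fsbigr => w _; apply: eq_bigr => j _.
  by rewrite /loop_weight /gammas odd_double doubleK.
congr (_ * _); apply: eq_bigr => u _.
by rewrite halfE /gammas (negbTE (even u)).
Qed.
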